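(* Let $d\ge 2$ and let $C(L)$ be the number of self-avoiding walks in the hypercubic lattice $\mathbb{Z}^d$ that cross a hypercube of side length $L$ from one corner vertex to the diagonally opposite corner vertex. Then the limit $$\lim_{L\to\infty}\frac{1}{L^d}\log C(L)\equiv\log\lambda_d$$ exists and $\log\lambda_d<\infty$.
   Context: For a positive integer $L$, the hypercube of side $L$ is the subgraph of the lattice $\mathbb{Z}^d$ (nearest-neighbour edges) induced by the vertex set $\{0,1,\dots,L\}^d$. A self-avoiding walk is a nearest-neighbour lattice path that visits no vertex more than once. $C(L)$ counts the self-avoiding walks that stay in the hypercube of side $L$, start at a fixed corner vertex (say $(0,\dots,0)$) and end at the diagonally opposite corner vertex (say $(L,\dots,L)$). *)

(* Defs.v *)
From HB Require Import structures.
From mathcomp Require Import all_boot all_order all_algebra.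

Set Implicit Arguments.
Unset Strict Implicit.
Unset Printing Implicit Defensive.

Import Order.TTheory GRing.Theory Num.Theory.
Local Open Scope ring_scope.

Definition lattice (d : nat) : Type := {ffun 'I_d -> int}.

(* Points of Z^d are nearest neighbours iff their l^1-distance is 1. *)
Definition lattice_adj (d : nat) (x y : lattice d) : bool :=
  \sum_(i < d) `|x i - y i| == 1.

Definition cube (d L : nat) : finType := {ffun 'I_d -> 'I_L.+1}.

Definition cube_embed (d L : nat) (u : cube d L) : lattice d :=
  [ffun i => (u i : nat)%:Z].

Definition cube_adj (d L : nat) : rel (cube d L) :=
  [rel u v | lattice_adj (cube_embed u) (cube_embed v)].

Definition origin_corner (d L : nat) : cube d L := [ffun=> ord0].

Definition opposite_corner (d L : nat) : cube d L := [ffun=> ord_max].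

(* [p] lists the vertices of the walk after its starting vertex, so the walk *)
(* has [size p] steps.                                                       *)
Definition crossing_saw (d L : nat) (p : seq (cube d L)) : bool :=
  [&& path (@cube_adj d L) (origin_corner d L) p,
      uniq (origin_corner d L :: p)
    & last (origin_corner d L) p == opposite_corner d L].

(* The walks are counted by their number [n] of steps; the bound on [n] is   *)
(* no restriction, see [crossing_saw_size] and [num_crossingsP].             *)
Definition num_crossings (d L : nat) : nat :=
  (\sum_(n < #|cube d L|) #|[set p : n.-tuple (cube d L) | crossing_saw p]|)%N.

Lemma crossing_saw_size (d L : nat) (p : seq (cube d L)) :
  crossing_saw p -> (size p < #|cube d L|)%N.
Proof.
case/and3P=> _ /card_uniqP up _.
by rewrite -[(size p).+1]/(size (origin_corner d L :: p)) -up max_card.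
Qed.

Lemma num_crossingsP (d L : nat) :
  exists s : seq (seq (cube d L)),
    [/\ uniq s, forall p, (p \in s) = crossing_saw p
      & size s = num_crossings d L].
Proof.
pose W n := [set p : n.-tuple (cube d L) | crossing_saw p].
pose f n := [seq val p | p <- enum (W n)].
have fP n p : (p \in f n) = (size p == n) && crossing_saw p.
  apply/mapP/andP => [[t]|[sp cp]].
    by rewrite mem_enum inE => ct ->; rewrite size_tuple eqxx.
  by exists (Tuple sp) => //; rewrite mem_enum inE.
exists (flatten [seq f n | n <- iota 0 #|cube d L|]); split.
- elim: (#|cube d L|) {1}0%N => //= k IH m.
  rewrite cat_uniq IH andbT map_inj_uniq ?enum_uniq /=; last exact: val_inj.
  apply/hasPn => p /flatten_mapP[n]; rewrite mem_iota fP => /andP[mn _].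
  by case/andP=> /eqP sp _; rewrite fP sp gtn_eqF.
- move=> p; apply/flatten_mapP/idP => [[n _]|cp]; first by rewrite fP => /andP[].
  by exists (size p); rewrite ?fP ?eqxx // mem_iota /= add0n crossing_saw_size.
rewrite size_flatten /shape -map_comp sumnE big_map -/(index_iota 0 _).
rewrite -{1}[#|cube d L|]subn0 -/(index_iota 0 #|cube d L|) big_mkord.
by apply: eq_bigr => n _; rewrite /= size_map -cardE.
Qed.

(* Main.v *)
(* Let C(v) be the number of walks crossing the box with side vector v.       *)
(* Three boxes side by side in direction i are crossed one after the other,   *)
(* by reflecting the middle one in all other directions, so                   *)
(*   C(v, v_i := a + b + c + 2)                                               *)
(*     >= C(v, v_i := a) C(v, v_i := b) C(v, v_i := c),                       *)
(* and C is nondecreasing in v_i, since the final corner can be pushed        *)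
(* outwards. Hence a(n) := log C(n - 1) satisfies M^d a(n) <= a(N) for odd M  *)
(* with M n <= N, and as a(n) = O(n^d), a(n) / n^d converges to its supremum. *)
Require Import Defs.
From HB Require Import structures.
From mathcomp Require Import all_boot all_order all_algebra.
From mathcomp Require Import zify lra ring.
From mathcomp Require Import all_classical all_reals all_analysis.

Set Implicit Arguments.
Unset Strict Implicit.
Unset Printing Implicit Defensive.

Import Order.TTheory GRing.Theory Num.Theory.
Import numFieldNormedType.Exports.
Local Open Scope classical_set_scope.
Local Open Scope ring_scope.

(** A Fekete-type argument. If (2k+1)n <= N, a cube with N vertices per edge has room for a grid of
    (2k+1)^d cubes with n vertices per edge, and independently chosen crossings of these glue, after
    reflections, into one crossing of the large cube: C(n-1)^((2k+1)^d) <= C(N-1)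
    ([num_crossings_scale]). A walk is determined by its steps, fewer than (L+1)^d in number, so
    C(L) is at most exponential in (L+1)^d ([num_crossings_le]). The two bounds force the normalised
    logarithm to converge to a finite limit ([is_cvg_odd_superhomogeneous]); normalising by L
    instead of L+1 costs a factor tending to 1. *)

(** * Families of self-avoiding walks and their concatenation *)

Section WalkFamilies.
Variables (T : eqType) (e : rel T).
Implicit Types (D : pred T) (x y : T) (p q : seq T) (m n : nat).

(** The region [D] is recorded because walks in disjoint regions cannot meet, which keeps glued
    walks self-avoiding. *)
Definition saw D x y p :=
  [&& path e x p, uniq (x :: p), last x p == y & all D (x :: p)].

(** A lower bound witnessed by a list makes sense on the infinite lattice and is transported by
    injections. *)
Definition at_least_saws D x y m :=
  exists s : seq (seq T), [/\ uniq s, all (saw D x y) s & size s = m].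

Lemma at_least_saws_refl D x : D x -> at_least_saws D x x 1.
Proof. by move=> Dx; exists [:: [::]]; split=> //=; rewrite /saw /= eqxx Dx. Qed.

Lemma saw_cat D1 D2 x1 y1 x2 y2 p q :
  {in D2, forall z, ~~ D1 z} -> e y1 x2 ->
  saw D1 x1 y1 p -> saw D2 x2 y2 q -> saw (predU D1 D2) x1 y2 (p ++ x2 :: q).
Proof.
move=> D12 y1x2 /and4P[p1 u1 /eqP l1 a1] /and4P[p2 u2 /eqP l2 a2].
apply/and4P; split.
- by rewrite cat_path p1 l1 /= y1x2.
- rewrite -cat_cons cat_uniq u1 u2 andbT; apply/hasPn => z /(allP a2) D2z.
  by apply/negP => /(allP a1); apply/negP/D12.
- by rewrite last_cat /= l2.
- rewrite -cat_cons all_cat; apply/andP; split.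
    by apply: sub_all a1 => z /= ->.
  by apply: sub_all a2 => z /= ->; rewrite orbT.
Qed.

(** Distinct pairs glue to distinct walks: filtering the glued walk by [D1] returns the first
    factor. *)
Lemma at_least_saws_cat D1 D2 x1 y1 x2 y2 m n :
  {in D2, forall z, ~~ D1 z} -> e y1 x2 ->
  at_least_saws D1 x1 y1 m -> at_least_saws D2 x2 y2 n ->
  at_least_saws (predU D1 D2) x1 y2 (m * n).
Proof.
move=> D12 y1x2 [s [us sP sm]] [t [ut tP tn]].
exists [seq p ++ x2 :: q | p <- s, q <- t]; split.
- apply: allpairs_uniq => // -[? ?] [? ?] /allpairsP[[p q] /= [sp tq [-> ->]]].
  move=> /allpairsP[[p' q'] /= [sp' tq' [-> ->]]] /= E.
  have filt r r' : r \in s -> r' \in t -> seq.filter D1 (r ++ x2 :: r') = r.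
    move=> /(allP sP) /and4P[_ _ _ /= /andP[_ a1]].
    move=> /(allP tP) /and4P[_ _ _ a2].
    rewrite filter_cat (all_filterP a1) (_ : seq.filter _ _ = [::]) ?cats0 //.
    apply/eqP; rewrite -(negbK (_ == _)) -has_filter.
    by apply/hasPn => z /(allP a2) /D12.
  have pp' : p = p' by rewrite -(filt p q) // E filt.
  by move: E; rewrite pp' => /eqP; rewrite eqseq_cat // eqxx => /eqP[->].
- apply/allP => _ /allpairsP[[p q] /= [sp tq ->]].
  by apply: saw_cat D12 y1x2 _ _; [apply: (allP sP)|apply: (allP tP)].
- by rewrite size_allpairs sm tn.
Qed.

End WalkFamilies.

Lemma at_least_saws_map (T T' : eqType) (e : rel T) (e' : rel T') (f : T -> T')
    (D : pred T) (D' : pred T') x y m :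
  {in D &, injective f} -> {in D &, forall z t, e z t -> e' (f z) (f t)} ->
  (forall z, D z -> D' (f z)) ->
  at_least_saws e D x y m -> at_least_saws e' D' (f x) (f y) m.
Proof.
move=> finj fe fD [s [us sP sm]]; exists (map (map f) s); split.
- rewrite map_inj_in_uniq // => p q /(allP sP) /and4P[_ _ _ /= /andP[_ Dp]].
  move=> /(allP sP) /and4P[_ _ _ /= /andP[_ Dq]].
  elim: p q Dp Dq => [|a p IH] [|b q] //= /andP[Da Dp] /andP[Db Dq] [ab pq].
  by rewrite (finj a b) // (IH q).
- apply/allP => _ /mapP[p /(allP sP) /and4P[ep up /eqP lp Dp] {sP us sm} ->].
  apply/and4P; split; last 1 first.
  + by rewrite -map_cons all_map; apply: sub_all Dp => z /= /fD.
  + elim: p x ep Dp {up lp} => //= a p IH x /andP[xa ap] /andP[Dx /= Dp].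
    by rewrite IH // andbT fe //; case/andP: Dp.
  + rewrite -map_cons map_inj_in_uniq // => a b /(allP Dp) Da /(allP Dp) Db.
    exact: finj.
  + by rewrite last_map lp.
- by rewrite size_map.
Qed.

Lemma at_least_saws_sub (T : eqType) (e : rel T) (D D' : pred T) x y m :
  subpred D D' -> at_least_saws e D x y m -> at_least_saws e D' x y m.
Proof. by move=> DD'; apply: (@at_least_saws_map _ _ _ _ id). Qed.

(** * Gluing and stretching crossings of boxes *)

Section Boxes.
Variable d : nat.
Notation pt := {ffun 'I_d -> int}.
Notation sides := {ffun 'I_d -> nat}.
Notation adj := (@lattice_adj d : rel pt).
Implicit Types (v : sides) (i : 'I_d) (a b c m n : nat).

(** A lattice isometry: reflection of the coordinates in [s], then translation by [o]. *)
Definition motion (s : pred 'I_d) (o x : pt) : pt :=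
  [ffun j => if s j then o j - x j else o j + x j].

Lemma motion_inj s o : injective (motion s o).
Proof.
move=> x y /ffunP E; apply/ffunP => j; move: (E j); rewrite !ffunE.
by case: (s j) => /addrI // /oppr_inj.
Qed.

Lemma motion_adj s o (x y : pt) : adj x y -> adj (motion s o x) (motion s o y).
Proof.
rewrite /lattice_adj; congr (_ == _); apply: eq_bigr => j _; rewrite !ffunE.
by case: (s j); lia.
Qed.

Lemma adj_step i (x y : pt) :
  y i = x i + 1 -> (forall j, j != i -> y j = x j) -> adj x y.
Proof.
move=> yi yj; rewrite /lattice_adj (bigD1 i) //= big1 ?yi; last first.
  by move=> j /yj ->; rewrite subrr normr0.
by apply/eqP; lia.
Qed.

Definition box v : pred pt := [pred x : pt | [forall j, 0 <= x j <= (v j)%:Z]].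

Definition slab v i (lo hi : int) : pred pt :=
  [pred x : pt | box v x && (lo <= x i <= hi)].

Definition far_corner v : pt := [ffun j => (v j)%:Z].

Definition crossings v m :=
  at_least_saws adj (box v) ([ffun=> 0] : pt) (far_corner v) m.

Definition upd v i a : sides := [ffun j => if j == i then a else v j].

Lemma upd_id v i : upd v i (v i) = v.
Proof. by apply/ffunP => j; rewrite !ffunE; case: eqP => // ->. Qed.

(* [far] tells on which side the coordinates other than [i] lie; a crossing  *)
(* in direction [i] flips it.                                                 *)
Definition corner v i (t : nat) (far : bool) : pt :=
  [ffun j => if j == i then t%:Z else if far then (v j)%:Z else 0].

Lemma adj_corner v i t far : adj (corner v i t far) (corner v i t.+1 far).
Proof.
apply: (@adj_step i) => [|j /negPf ji]; rewrite !ffunE ?ji //.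
by rewrite eqxx; lia.
Qed.

(** The crossing is translated by [t] along [i] and, if [far], reflected in every other
    coordinate. *)
Lemma crossings_slab v i a b (t : nat) far m : (t + a <= b)%N ->
  crossings (upd v i a) m ->
  at_least_saws adj (slab (upd v i b) i t (t + a)%N)
    (corner v i t far) (corner v i (t + a) (~~ far)) m.
Proof.
move=> tab; pose f := motion [pred j | far && (j != i)] (corner v i t far).
have -> : corner v i t far = f [ffun=> 0].
  by apply/ffunP => j; rewrite !ffunE oppr0 addr0 if_same.
have -> : corner v i (t + a) (~~ far) = f (far_corner (upd v i a)).
  apply/ffunP => j; rewrite !ffunE /=; case: eqP => _; rewrite ?andbF ?andbT //.
  by case: far {f}; rewrite /= ?subrr ?add0r.
apply: at_least_saws_map.
- by move=> x' y' _ _; apply: motion_inj.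
- by move=> x' y' _ _; apply: motion_adj.
move=> z /forallP /= Dz; apply/andP; split; last first.
  by move: (Dz i); rewrite !ffunE /= eqxx andbF; lia.
apply/forallP => j; move: (Dz j); rewrite !ffunE /=.
have [->|ji] := eqVneq j i; first by rewrite andbF; lia.
by rewrite andbT; case: (far); lia.
Qed.

Lemma slab_disjoint v i (s t s' t' : int) : t < s' ->
  {in slab v i s' t', forall x, ~~ slab v i s t x}.
Proof.
move=> ts x /andP[_ /andP[s'x _]]; apply/negP => /andP[_ /andP[_ xt]]; lia.
Qed.

Lemma corner_origin v i : corner v i 0 false = [ffun=> 0].
Proof. by apply/ffunP => j; rewrite !ffunE if_same. Qed.

Lemma corner_far v i a : corner v i a true = far_corner (upd v i a).
Proof. by apply/ffunP => j; rewrite !ffunE; case: ifP. Qed.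

(** Each crossing flips the other coordinates, so an odd number of them is needed to finish at the
    far corner. The two extra units of length are the joining edges. *)
Lemma crossings_cat3 v i a b c m n k :
  crossings (upd v i a) m -> crossings (upd v i b) n ->
  crossings (upd v i c) k ->
  crossings (upd v i (a + b + c).+2) (m * n * k).
Proof.
move=> am bn ck; set w := (a + b + c).+2.
have h1 := @crossings_slab v i a w 0 false m ltac:(lia) am.
have h2 := @crossings_slab v i b w a.+1 true n ltac:(lia) bn.
have h3 := @crossings_slab v i c w (a.+1 + b).+1 false k ltac:(lia) ck.
have h12 := at_least_saws_cat (@slab_disjoint _ i 0 a a.+1 _ ltac:(lia))
  (@adj_corner v i a true) h1 h2.
have disj : {in slab (upd v i w) i (a.+1 + b).+1 ((a.+1 + b).+1 + c)%N,
    forall x, ~~ predU (slab (upd v i w) i 0 (0 + a)%N)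
                       (slab (upd v i w) i a.+1 (a.+1 + b)%N) x}.
  move=> x sx; rewrite /= negb_or; apply/andP; split;
    apply: slab_disjoint sx; lia.
have := at_least_saws_cat disj (@adj_corner v i (a.+1 + b) false) h12 h3.
rewrite corner_origin /= (_ : (_ + c)%N = w) ?corner_far; last lia.
by apply: at_least_saws_sub => x /= /orP[/orP[]|] /andP[].
Qed.

(** One vertex is appended beyond the far corner; the second slab carries only a walk without
    steps. *)
Lemma crossings_succ v i a m :
  crossings (upd v i a) m -> crossings (upd v i a.+1) m.
Proof.
move=> am.
have h1 := @crossings_slab v i a a.+1 0 false m ltac:(lia) am.
have h2 : at_least_saws adj (slab (upd v i a.+1) i a.+1 a.+1)
    (corner v i a.+1 true) (corner v i a.+1 true) 1.
  apply: at_least_saws_refl; apply/andP; split; last first.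
    by rewrite !ffunE eqxx lexx.
  by apply/forallP => j /=; rewrite !ffunE; case: ifP => _; lia.
have := at_least_saws_cat (@slab_disjoint _ i 0 a a.+1 _ ltac:(lia))
  (@adj_corner v i a true) h1 h2.
rewrite muln1 corner_origin corner_far.
by apply: at_least_saws_sub => x /= /orP[] /andP[].
Qed.

Lemma crossings_leq v i a b m : (a <= b)%N ->
  crossings (upd v i a) m -> crossings (upd v i b) m.
Proof.
move=> /subnKC <-; elim: (b - a)%N => [|k IH] am; first by rewrite addn0.
by rewrite addnS; apply/crossings_succ/IH.
Qed.

Lemma crossings_stretch v i a b k m : (k.*2.+1 * a.+1 <= b.+1)%N ->
  crossings (upd v i a) m -> crossings (upd v i b) (m ^ k.*2.+1).
Proof.
move=> kab am; apply: (@crossings_leq _ _ (k.*2.+1 * a.+1).-1); first lia.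
elim: k {kab} => [|k IH]; first by rewrite mul1n expn1.
have := crossings_cat3 IH am am; rewrite -!expnSr.
by rewrite (_ : (_ + a + a).+2 = (k.+1.*2.+1 * a.+1).-1); last lia.
Qed.

(** The coordinates are stretched one at a time, each raising the count to the power 2k+1. *)
Lemma crossings_scale a b k m : (k.*2.+1 * a.+1 <= b.+1)%N ->
  crossings [ffun=> a] m -> crossings [ffun=> b] (m ^ (k.*2.+1 ^ d)).
Proof.
move=> kab am.
have : forall t, (t <= d)%N ->
    crossings [ffun j : 'I_d => if (j < t)%N then b else a] (m ^ (k.*2.+1 ^ t)).
  elim=> [_|t IH td].
    by rewrite expn1; congr (crossings _ _): am;
       apply/ffunP => j; rewrite !ffunE.
  have := IH (ltnW td); set v := finfun _; set w := finfun _ => vm.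
  pose i := Ordinal td.
  have -> : w = upd v i b.
    apply/ffunP => j; rewrite !ffunE -val_eqE /= ltnS leq_eqVlt.
    by case: eqP.
  rewrite expnSr expnM; apply: (@crossings_stretch _ _ a) => //.
  by rewrite (_ : a = v i) ?upd_id // ffunE /= ltnn.
move/(_ d (leqnn d)); congr (crossings _ _).
by apply/ffunP => j; rewrite !ffunE ltn_ord.
Qed.

Lemma crossings0 : crossings [ffun=> 0%N] 1.
Proof.
rewrite /crossings (_ : far_corner _ = ([ffun=> 0] : pt)); last first.
  by apply/ffunP => j; rewrite !ffunE.
apply: at_least_saws_refl; apply/forallP => j; rewrite !ffunE; lia.
Qed.

(** * Counts in the finite cube: comparison with boxes, and an upper bound *)

Lemma cube_embed_inj L : injective (@cube_embed d L).
Proof.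
move=> u v /ffunP E; apply/ffunP => j; apply: val_inj.
by have := E j; rewrite !ffunE => -[].
Qed.

Lemma crossings_num_crossings L : crossings [ffun=> L] (num_crossings d L).
Proof.
have [s [us sP <-]] := num_crossingsP d L; rewrite /crossings.
have -> : ([ffun=> 0] : pt) = cube_embed (origin_corner d L).
  by apply/ffunP => j; rewrite !ffunE.
have -> : far_corner [ffun=> L] = cube_embed (opposite_corner d L).
  by apply/ffunP => j; rewrite !ffunE.
apply: (@at_least_saws_map _ _ (@cube_adj d L) _ _ predT) => //.
- by move=> u v _ _; apply: cube_embed_inj.
- move=> u _; apply/forallP => j; rewrite !ffunE; have := ltn_ord (u j); lia.
exists s; split=> //; apply/allP => p; rewrite sP => /and3P[p1 p2 p3].
by rewrite /saw p1 p2 p3 all_predT.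
Qed.

(** Box walks map injectively into the complete list of [num_crossingsP]; with
    [crossings_num_crossings], the count is the largest such [m]. *)
Lemma num_crossings_max L m :
  crossings [ffun=> L] m -> (m <= num_crossings d L)%N.
Proof.
pose f (x : pt) : cube d L := [ffun j => inord `|x j|%N].
have fK x : box [ffun=> L] x -> cube_embed (f x) = x.
  move=> /forallP /= Dx; apply/ffunP => j; move: (Dx j); rewrite !ffunE => Dj.
  by rewrite inordK; [case/andP: Dj => /gez0_abs|lia].
move=> /(@at_least_saws_map _ _ adj (@cube_adj d L) f _ predT).
case=> // [x y Dx Dy xy|x y Dx Dy xy|s [us sP <-]].
- by rewrite -(fK x) // -(fK y) // xy.
- by rewrite /cube_adj /= !fK.
have [t [ut tP <-]] := num_crossingsP d L; apply: uniq_leq_size => // p.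
move=> /(allP sP) /and4P[p1 p2 p3 _]; rewrite tP.
have e0 : f ([ffun=> 0] : pt) = origin_corner d L.
  by apply: cube_embed_inj; rewrite fK; [apply/ffunP => j|apply/forallP => j];
     rewrite !ffunE.
have e1 : f (far_corner [ffun=> L]) = opposite_corner d L.
  apply: cube_embed_inj; rewrite fK; [apply/ffunP => j|apply/forallP => j];
    rewrite !ffunE //; lia.
by move: p1 p2 p3; rewrite e0 e1 => p1 p2 p3; apply/and3P.
Qed.

Lemma num_crossings_scale a b k : (k.*2.+1 * a.+1 <= b.+1)%N ->
  (num_crossings d a ^ (k.*2.+1 ^ d) <= num_crossings d b)%N.
Proof.
by move=> kab; apply/num_crossings_max/crossings_scale/crossings_num_crossings.
Qed.

Lemma num_crossings_gt0 L : (0 < num_crossings d L)%N.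
Proof.
apply: num_crossings_max; have := @crossings_scale 0 L 0 1 _ crossings0.
by rewrite !exp1n; apply.
Qed.

(* The digits 0, 1, 2 of [t] encode the displacements -1, 0, 1; all the       *)
(* 3 ^ d of them are allowed, as any exponential bound will do.               *)
Definition shift L (u : cube d L) (t : {ffun 'I_d -> 'I_3}) : cube d L :=
  [ffun j => inord (u j + t j).-1].

Lemma shift_surj L (u v : cube d L) :
  cube_adj u v -> exists t, v = shift u t.
Proof.
rewrite /cube_adj /= /lattice_adj => /eqP E.
exists [ffun j => inord (v j + 1 - u j)]; apply/ffunP => j.
have : `|cube_embed u j - cube_embed v j| <= 1.
  by rewrite -E (bigD1 j) //= lerDl sumr_ge0.
rewrite !ffunE; move: (u j) (v j) => a b ab.
have tj : (b + 1 - a < 3)%N by lia.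
have eb : (a + (b + 1 - a)).-1 = b by lia.
by rewrite (inordK tj) eb inord_val.
Qed.

(** A walk is recovered by [scanl] from its start and its [n] displacements. *)
Lemma card_walks L (u : cube d L) n :
  (#|[set p : n.-tuple (cube d L) | path (@cube_adj d L) u p]| <= (3 ^ d) ^ n)%N.
Proof.
pose f (t : n.-tuple {ffun 'I_d -> 'I_3}) := [tuple of scanl (@shift L) u t].
have <- : #|{: n.-tuple {ffun 'I_d -> 'I_3}}| = ((3 ^ d) ^ n)%N.
  by rewrite card_tuple card_ffun !card_ord.
apply: leq_trans (subset_leq_card _) (leq_imset_card f _).
apply/fintype.subsetP => p; rewrite inE => up.
suff [s sn pE] : exists2 s, size s = n & tval p = scanl (@shift L) u s.
  by apply/imsetP; exists (Tuple (introT eqP sn)) => //; apply: val_inj.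
case: p up => p /= /eqP <- {f n}.
elim: p u => [|v p IH] u /=; first by move=> _; exists [::].
case/andP=> /shift_surj[t ->] /IH[s ss pE].
by exists (t :: s); rewrite /= ?ss -?pE.
Qed.

Lemma num_crossings_le L : (0 < d)%N ->
  (num_crossings d L <= (3 ^ d) ^ (L.+1 ^ d))%N.
Proof.
move=> d0; have -> : (L.+1 ^ d)%N = #|cube d L|.
  by rewrite card_ffun !card_ord.
apply: (@leq_trans (\sum_(n < #|cube d L|) (3 ^ d) ^ n)).
  apply: leq_sum => n _; apply: leq_trans _ (card_walks (origin_corner d L) n).
  by apply/subset_leq_card/fintype.subsetP => p; rewrite !inE => /and3P[].
have K2 : (2 <= 3 ^ d)%N by rewrite (leq_trans _ (leq_pexp2l _ d0)).
(* For K >= 2, the sum of K^n over n < N is at most K^N. *)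
elim: #|_| => [|n IH]; first by rewrite big_ord0.
rewrite big_ord_recr /= expnS; apply: leq_trans (leq_mul K2 (leqnn _)).
by rewrite mul2n -addnn leq_add2r.
Qed.

End Boxes.

(** * Convergence of the normalised sequence *)

Section Limits.
Variables (R : realType) (d : nat).

Lemma cvg_exp_1D_inv (c : R) : (1 + c / n%:R) ^+ d @[n --> \oo] --> (1 : R).
Proof.
have inv0 : (n%:R : R)^-1 @[n --> \oo] --> (0 : R).
  apply/(@gtr0_cvgV0 _ _ _ _ (fun n => n%:R)); last by apply/cvgrnyP.
  by near=> n; rewrite ltr0n; near: n; exists 1%N.
have : 1 + c / n%:R @[n --> \oo] --> (1 : R).
  have := cvgD (cvg_cst (1 : R)) (cvgM (cvg_cst c) inv0).
  by rewrite mulr0 addr0; apply.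
move=> /(continuous_cvg _ (@exprn_continuous R d 1)).
by rewrite expr1n.
Unshelve. all: by end_near.
Qed.

(** The limit is the supremum: if a(m)/m^d is nearly maximal, every large n contains an odd multiple
    of m within 2m of it, so a(n)/n^d is at least (1 - 2m/n)^d a(m)/m^d. *)
Lemma is_cvg_odd_superhomogeneous (a : nat -> R) (B : R) :
  (forall n, 0 <= a n) -> (forall n, (0 < n)%N -> a n <= B * n%:R ^+ d) ->
  (forall m n k, (0 < m)%N -> (k.*2.+1 * m <= n)%N ->
     (k.*2.+1)%:R ^+ d * a m <= a n) ->
  cvg ((a n / n%:R ^+ d) @[n --> \oo]).
Proof.
move=> a0 aB aM.
pose S := [set x | exists2 n, (0 < n)%N & x = a n / n%:R ^+ d].
have pow_gt0 n : (0 < n)%N -> 0 < n%:R ^+ d :> R.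
  by move=> n0; rewrite exprn_gt0 // ltr0n.
have supS : has_sup S.
  split; first by exists (a 1%N / 1%:R ^+ d), 1%N.
  by exists B => _ [n n0 ->]; rewrite ler_pdivrMr ?aB // pow_gt0.
apply/cvg_ex; exists (sup S); apply/cvgrPdist_lt => e e0.
have [_ [m m0 ->]] := sup_adherent e0 supS; set c := a m / _ => ec.
have c0 : 0 <= c by rewrite divr_ge0 // ltW // pow_gt0.
have m0R : 0 < m%:R :> R by rewrite ltr0n.
have lim : (1 + (- m.*2%:R) / n%:R) ^+ d * c @[n --> \oo] --> c.
  by rewrite -[X in _ --> X]mul1r; apply: cvgMl; apply: cvg_exp_1D_inv.
near=> n.
have n0 : (0 < n)%N by near: n; exists 1%N.
have n0R : 0 < n%:R :> R by rewrite ltr0n.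
have m2n : (m.*2 <= n)%N by near: n; exists m.*2.
have nS : a n / n%:R ^+ d <= sup S by apply: sup_upper_bound => //; exists n.
rewrite ger0_norm ?subr_ge0 // ltrBlDr addrC -ltrBlDr.
have : sup S - e < (1 + (- m.*2%:R) / n%:R) ^+ d * c.
  by near: n; apply: cvgr_gt lim _ ec.
move=> /lt_le_trans; apply.
(* This makes 2k+1 the largest odd number not exceeding [n %/ m]. *)
pose k := (n %/ m).-1./2.
have mn : (0 < n %/ m)%N by rewrite divn_gt0 //; lia.
have kn : (k.*2.+1 * m <= n)%N.
  apply: leq_trans (leq_trunc_div n m); rewrite leq_mul2r; apply/orP; right.
  rewrite /k; lia.
have nk : (n <= m.*2 + k.*2.+1 * m)%N.
  have := ltn_ceil n m0.
  have : ((n %/ m).+1 <= k.*2.+1 + 2)%N by rewrite /k; lia.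
  move: (n %/ m)%N => q; nia.
have h := aM _ _ _ m0 kn.
apply: (@le_trans _ _ (k.*2.+1%:R ^+ d * a m / n%:R ^+ d)); last first.
  by rewrite ler_pM2r // invr_gt0 pow_gt0.
rewrite (_ : k.*2.+1%:R ^+ d * a m / _ =
    (k.*2.+1%:R * m%:R / n%:R) ^+ d * c); last first.
  rewrite /c !exprMn exprVn; field.
  by rewrite !gt_eqF ?pow_gt0.
apply: ler_wpM2r => //.
have E : 1 + (- m.*2%:R) / n%:R <= k.*2.+1%:R * m%:R / n%:R :> R.
  rewrite ler_pdivlMr // mulrDl mulfVK ?gt_eqF // mul1r.
  by rewrite lerBlDr addrC -natrM -natrD ler_nat.
apply: lerXn2r E; rewrite nnegrE.
  by rewrite mulNr subr_ge0 ler_pdivrMr // mul1r ler_nat.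
by rewrite divr_ge0 // mulr_ge0.
Unshelve. all: by end_near.
Qed.

End Limits.

Theorem theorem4 (R : realType) (d : nat) (hd : (2 <= d)%N) :
  exists lambda : R, 0 < lambda /\
    (fun L : nat => ln ((num_crossings d L)%:R : R) / (L%:R ^+ d)) @ \oo
      --> ln lambda.
Proof.
(* Indexing by vertices per edge, not side length, makes the scaling hypothesis homogeneous. *)
pose a n : R := ln (num_crossings d n.-1)%:R.
have C0 L : 0 < (num_crossings d L)%:R :> R by rewrite ltr0n num_crossings_gt0.
have : cvg ((a n / n%:R ^+ d) @[n --> \oo]).
  apply: (@is_cvg_odd_superhomogeneous _ _ _ (ln (3 ^ d)%:R)).
  - by move=> n; rewrite ln_ge0 // ler1n num_crossings_gt0.
  - case=> // n _; rewrite -natrX mulr_natr -lnXn ?ltr0n ?expn_gt0 //.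
    rewrite ler_ln ?posrE ?exprn_gt0 ?ltr0n ?expn_gt0 ?num_crossings_gt0 //.
    by rewrite -natrX ler_nat num_crossings_le //; lia.
  - case=> // m [|n] k _ kmn //.
    rewrite -natrX mulr_natl -lnXn // ler_ln ?posrE ?exprn_gt0 //.
    by rewrite -natrX ler_nat num_crossings_scale.
move=> /cvg_ex[l al]; exists (expR l); split; first exact: expR_gt0.
(* The limit is written [l * 1] to match the factor (1 + 1/n)^d, which turns (n+1)^d into n^d in the
   denominator. *)
rewrite expRK -[l]mulr1; move: al; rewrite -cvg_shiftS => al.
apply: cvg_trans (cvgM al (@cvg_exp_1D_inv R d 1)).
apply: near_eq_cvg; near=> n.
have n0 : n%:R != 0 :> R by rewrite pnatr_eq0 -lt0n; near: n; exists 1%N.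
rewrite /= /a /= -[n.+1]addn1 natrD -exprVn -exprVn.
rewrite -mulrA -exprMn; congr (_ * _ ^+ _); field.
by rewrite n0 natr1 pnatr_eq0.
Unshelve. all: by end_near.
Qed.
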